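(* Let $A=A(T(4,2,1))$ be any inner-faithful $T(4,2,1)$-module algebra which, as an algebra, is $\Bbbk[u]/(u^4-1)$ with $g\cdot u=\zeta u$ for a primitive fourth root of unity $\zeta\in\Bbbk$. Then the action of $T(4,2,1)$ on $A$ cannot be extended to an action of the Drinfel'd double $D(T(4,2,1))$ on $A$ in any way that makes $A$ a $D(T(4,2,1))$-module algebra.
   Context: $\Bbbk$ is an algebraically closed field of characteristic $0$. $T(4,2,1)$ is the Hopf algebra generated by a grouplike element $g$ and an element $x$ with $\Delta(x)=g\otimes x+x\otimes 1$, subject to $g^4=1$, $x^2=g^2-1$, $gx=-xg$. For a Hopf algebra $H$, an $H$-module algebra is an algebra $A$ that is a left $H$-module with $h\cdot(ab)=(h_{(1)}\cdot a)(h_{(2)}\cdot b)$ and $h\cdot 1_A=\epsilon(h)1_A$. The action is inner-faithful if $I\cdot A\neq 0$ for every nonzero Hopf ideal $I$ of $H$. For a finite-dimensional Hopf algebra $H$ with antipode $S$, the Drinfel'd double $D(H)$ is the Hopf algebra $H^{*\mathrm{cop}}\otimes H$ as a coalgebra, with unit $\epsilon\otimes 1$ and multiplication $$(p\otimes a)(q\otimes b)=\langle q_{(1)},S^{-1}(a_{(3)})\rangle\langle q_{(3)},a_{(1)}\rangle\; p\,q_{(2)}\otimes a_{(2)}b ,$$ where $H^*$ is the dual Hopf algebra (multiplication dual to $\Delta_H$, comultiplication dual to the multiplication of $H$). $H$ is embedded in $D(H)$ by $a\mapsto\epsilon\otimes a$, and an extension of an $H$-action is an action of $D(H)$ restricting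 to it. *)

(* Defs.v *)
From HB Require Import structures.
From mathcomp Require Import all_boot all_order all_algebra all_field.

Set Implicit Arguments.
Unset Strict Implicit.
Unset Printing Implicit Defensive.

Import GRing.Theory.
Local Open Scope ring_scope.

Section Tensor.
Variable K : fieldType.
Implicit Types V W : vectType K.

(* The tensor product is modelled by coordinates in the bases vbasis {:V} and
   vbasis {:W}; tlift_tens and tlift_eq below are its universal property. *)
Definition tensor V W : Type := 'M[K]_(\dim {:V}, \dim {:W}).

Definition tens V W (v : V) (w : W) : tensor V W :=
  \matrix_(i, j) (coord (vbasis {:V}) i v * coord (vbasis {:W}) j w).

(* For bilinear f, the linear map v ⊗ w |-> f v w. *)
Definition tlift V W (U : lmodType K) (f : V -> W -> U) (t : tensor V W) : U :=
  \sum_i \sum_j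
    (t : 'M_(_, _)) i j *: f (tnth (vbasis {:V}) i) (tnth (vbasis {:W}) j).

(* The image in V ⊗ W of the tensor product of two subspaces. *)
Definition tensv V W (M : {vspace V}) (N : {vspace W}) : {vspace tensor V W} :=
  <<[seq tens v w | v <- vbasis M, w <- vbasis N]>>%VS.

Lemma tlift_tens V W (U : lmodType K) (f : V -> W -> U) v w :
    (forall w, linear (f^~ w)) -> (forall v, linear (f v)) ->
  tlift f (tens v w) = f v w.
Proof.
move=> fl fr.
pose fL w := GRing.isLinear.Build K V U *:%R (f^~ w) (fl w).
pose FL w : {linear V -> U} := HB.pack (f^~ w) (fL w).
pose fR v := GRing.isLinear.Build K W U *:%R (f v) (fr v).
pose FR v : {linear W -> U} := HB.pack (f v) (fR v).
rewrite {2}(coord_vbasis (memvf v)) -[f _ w]/(FL w _) linear_sum.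
apply: eq_bigr => i _; rewrite linearZ /= [in RHS](coord_vbasis (memvf w)).
rewrite -[f _ (\sum_i _)]/(FR _ _) linear_sum scaler_sumr.
by apply: eq_bigr => j _; rewrite linearZ /= mxE scalerA !(tnth_nth 0).
Qed.

Lemma tlift_is_linear V W (U : lmodType K) (f : V -> W -> U) :
  linear (tlift f).
Proof.
move=> c s t; rewrite /tlift scaler_sumr -big_split /=; apply: eq_bigr => i _.
rewrite scaler_sumr -big_split /=; apply: eq_bigr => j _.
by rewrite !mxE scalerDl scalerA.
Qed.

Lemma tensE V W (t : tensor V W) : t = tlift (@tens V W) t.
Proof.
apply/matrixP => i j; rewrite /tlift.
have cb (X : vectType K) (k l : 'I_(\dim {:X})) :
    coord (vbasis {:X}) k (tnth (vbasis {:X}) l) = (l == k)%:R.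
  by rewrite (tnth_nth 0) coord_free // (basis_free (vbasisP _)).
rewrite summxE (bigD1 i) //= summxE (bigD1 j) //= !mxE !cb !eqxx !mulr1.
rewrite !big1 ?addr0 // => [i' ni|j' nj].
  by rewrite summxE big1 // => j' _; rewrite !mxE !cb (negPf ni) mul0r mulr0.
by rewrite !mxE !cb (negPf nj) !mulr0.
Qed.

Lemma tlift_eq V W (U : lmodType K) (F : {linear tensor V W -> U}) t :
  F t = tlift (fun v w => F (tens v w)) t.
Proof.
rewrite {1}(tensE t) linear_sum; apply: eq_bigr => i _.
by rewrite linear_sum; apply: eq_bigr => j _; rewrite linearZ.
Qed.

End Tensor.

Section Hopf.
Variable K : fieldType.

(* In Sweedler notation, h_(1) ⊗ h_(2) |-> f h_(1) h_(2). *)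
Definition sweedler2 (V : vectType K) (U : lmodType K) (D : V -> tensor V V)
    (f : V -> V -> U) (h : V) : U :=
  tlift f (D h).

Definition sweedler3 (V : vectType K) (U : lmodType K) (D : V -> tensor V V)
    (f : V -> V -> V -> U) (h : V) : U :=
  sweedler2 D (fun h1 h' => sweedler2 D (f h1) h') h.

Definition tmul (V W : vectType K) (mV : V -> V -> V) (mW : W -> W -> W)
    (s t : tensor V W) : tensor V W :=
  tlift (fun v w => tlift (fun v' w' => tens (mV v v') (mW w w')) t) s.

Record hopf_struct (H : falgType K) := HopfStruct {
  comul : 'Hom(H, tensor H H);
  counit : 'Hom(H, K^o);
  antipode : 'End(H);
  comulA : forall h,
    sweedler2 comul
      (fun a b => sweedler2 comul (fun a1 a2 => tens a1 (tens a2 b)) a) h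
    = sweedler2 comul (fun a b => tens a (comul b)) h;
  counitl : forall h, sweedler2 comul (fun a b => (counit a : K) *: b) h = h;
  counitr : forall h, sweedler2 comul (fun a b => (counit b : K) *: a) h = h;
  comul1 : comul 1 = tens 1 1;
  comulM : forall a b, comul (a * b) = tmul *%R *%R (comul a) (comul b);
  counit1 : counit 1 = 1;
  counitM : forall a b, counit (a * b) = (counit a : K) * (counit b : K);
  antipodel : forall h,
    sweedler2 comul (fun a b => antipode a * b) h = (counit h : K) *: 1;
  antipoder : forall h,
    sweedler2 comul (fun a b => a * antipode b) h = (counit h : K) *: 1
}.

Definition hopf_ideal (H : falgType K) (S : hopf_struct H) (I : {vspace H}) :=
  [/\ ({:H} * I <= I)%VS, (I * {:H} <= I)%VS,
      (comul S @: I <= tensv I {:H} + tensv {:H} I)%VS,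
      (forall h, h \in I -> counit S h = 0)
    & (antipode S @: I <= I)%VS].

(* The operations of a bialgebra on which the notion of module algebra
   depends, without its axioms. *)
Record bialg_ops (V : vectType K) := BialgOps {
  bmul : V -> V -> V;
  bone : V;
  bcomul : V -> tensor V V;
  bcounit : V -> K
}.

Definition hopf_ops (H : falgType K) (S : hopf_struct H) : bialg_ops H :=
  BialgOps *%R 1 (comul S) (counit S).

Record module_algebra (V : vectType K) (B : bialg_ops V) (A : algType K)
    (act : V -> A -> A) : Prop := ModuleAlgebra {
  act_linl : forall a, linear (act^~ a);
  act_linr : forall h, linear (act h);
  act1 : forall a, act (bone B) a = a;
  actM : forall h k a, act (bmul B h k) a = act h (act k a);
  act_mul : forall h a b,
    act h (a * b) = sweedler2 (bcomul B) (fun h1 h2 => act h1 a * act h2 b) h;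
  act_one : forall h, act h 1 = bcounit B h *: 1
}.

Definition inner_faithful (H : falgType K) (S : hopf_struct H) (A : algType K)
    (act : H -> A -> A) :=
  forall I : {vspace H}, hopf_ideal S I -> I != 0%VS ->
    exists2 h, h \in I & exists a, act h a != 0.

Definition dual (V : vectType K) : Type := 'Hom(V, K^o).

Section Double.
Variables (H : falgType K) (S : hopf_struct H).
Implicit Types p q : dual H.

Definition pairing p (h : H) : K := (p : 'Hom(H, K^o)) h.

Definition dual_mul p q : dual H :=
  linfun (sweedler2 (comul S)
    (fun a b => pairing p a * pairing q b : K^o)).

(* <q_(1), a> <q_(2), b> = <q, a b>, written out in the dual basis. *)
Definition dual_comul q : tensor (dual H) (dual H) :=
  let e := vbasis {:H} in
  let e' i : dual H := linfun (coord e i : H -> K^o) in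
  \sum_i \sum_j pairing q (tnth e i * tnth e j) *: tens (e' i) (e' j).

Lemma dual_mulE p q a :
  pairing (dual_mul p q) a
  = sweedler2 (comul S) (fun b c => pairing p b * pairing q c : K^o) a.
Proof.
pose f := sweedler2 (comul S) (fun b c => pairing p b * pairing q c : K^o).
have fl : linear f.
  by move=> c u v; rewrite /f /sweedler2 linearP tlift_is_linear.
pose fL := GRing.isLinear.Build K H K^o *:%R f fl.
pose F : {linear H -> K^o} := HB.pack f fL.
by rewrite /pairing /dual_mul -[sweedler2 _ _]/(F : H -> K^o) lfunE.
Qed.

Lemma dual_comulE q a b :
  sweedler2 dual_comul (fun q1 q2 => pairing q1 a * pairing q2 b : K^o) q
  = pairing q (a * b).
Proof.
pose B (q1 q2 : dual H) : K^o := pairing q1 a * pairing q2 b.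
pose TL := GRing.isLinear.Build K (tensor (dual H) (dual H)) K^o *:%R
  (tlift B) (tlift_is_linear B).
pose T : {linear tensor (dual H) (dual H) -> K^o} := HB.pack (tlift B) TL.
rewrite /sweedler2 -/B -[LHS]/(T (dual_comul q)) /dual_comul linear_sum.
rewrite [in RHS](coord_vbasis (memvf a)) mulr_suml /pairing linear_sum.
apply: eq_bigr => i _; rewrite linear_sum.
rewrite [in RHS](coord_vbasis (memvf b)) mulr_sumr linear_sum.
apply: eq_bigr => j _; rewrite linearZ /= tlift_tens.
- rewrite /B /pairing !lfunE /= -scalerAl -scalerAr !linearZ /= !(tnth_nth 0).
  by congr (_ *: _); exact: mulrC.
- by move=> w c u v; rewrite /B /pairing add_lfunE scale_lfunE mulrDl scalerAl.
- by move=> w c u v; rewrite /B /pairing add_lfunE scale_lfunE mulrDr scalerAr.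
Qed.

Definition drinfeld_double : Type := tensor (dual H) H.

(* antipode S is bijective since H is finite dimensional, so the linear
   inverse _^-1%VF is its two-sided inverse. *)
Definition drinfeld_mul_tens p (a : H) q (b : H) : drinfeld_double :=
  sweedler3 dual_comul (fun q1 q2 q3 =>
    sweedler3 (comul S) (fun a1 a2 a3 =>
      (pairing q1 ((antipode S)^-1%VF a3) * pairing q3 a1) *:
        (tens (dual_mul p q2) (a2 * b) : drinfeld_double)) a) q.

Definition drinfeld_mul (s t : drinfeld_double) : drinfeld_double :=
  tlift (fun p a => tlift (fun q b => drinfeld_mul_tens p a q b) t) s.

Definition drinfeld_one : drinfeld_double := tens (counit S : dual H) 1.

(* The coalgebra H^*cop ⊗ H: p ⊗ a |-> (p_(2) ⊗ a_(1)) ⊗ (p_(1) ⊗ a_(2)). *)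
Definition drinfeld_comul (s : drinfeld_double) :
    tensor drinfeld_double drinfeld_double :=
  tlift (fun p a =>
    sweedler2 dual_comul (fun p1 p2 =>
      sweedler2 (comul S) (fun a1 a2 =>
        tens (tens p2 a1 : drinfeld_double)
             (tens p1 a2 : drinfeld_double)) a) p) s.

Definition drinfeld_counit (s : drinfeld_double) : K :=
  tlift (fun p a => pairing p 1 * (counit S a : K) : K^o) s.

Definition drinfeld_ops : bialg_ops drinfeld_double :=
  BialgOps drinfeld_mul drinfeld_one drinfeld_comul drinfeld_counit.

Definition drinfeld_incl (a : H) : drinfeld_double :=
  tens (counit S : dual H) a.

End Double.

Definition T421_rel (B : algType K) (g x : B) :=
  [/\ g ^+ 4 = 1, x ^+ 2 = g ^+ 2 - 1 & g * x = - (x * g)].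

(* H, with its elements g and x, is T(4,2,1): the algebra presented by the
   generators g, x and the relations T421_rel, with the given coproducts.
   The counit and the antipode are then determined. *)
Record is_T421 (H : falgType K) (S : hopf_struct H) (g x : H) : Prop := IsT421 {
  T421_gen : agenv <<[:: g; x]>> = {:H}%VS;
  T421_relP : T421_rel g x;
  T421_univ : forall (B : algType K) (g' x' : B), T421_rel g' x' ->
    exists f : {lrmorphism H -> B}, f g = g' /\ f x = x';
  T421_comul_g : comul S g = tens g g;
  T421_counit_g : counit S g = 1;
  T421_comul_x : comul S x = tens g x + tens x 1
}.

End Hopf.

(* Main.v *)
(* An action of the double is an action of H together with a compatible
   (Yetter-Drinfeld) coaction: write q.u^k = sum_j <q, c_kj> u^j with c_kj in H.
   Compatibility with g gives zeta^j g c_kj = zeta^k c_kj g; as g^2 is central,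
   q.u = <q, c1> u + <q, c3> u^3 and q.u^3 = <q, d1> u + <q, d3> u^3, where c1
   and d3 commute with g while c3 and d1 anticommute with it. In particular
   c1 is a combination of powers of g, and comparing coproducts forces
   d1 ⊗ c3 = 0. Multiplicativity on u u^3 = 1 gives d3 c1 + d1 c3 = 1 and
   d1 c1 + d3 c3 = 0, hence c3 = d1 = 0 and d3 c1 = 1. Since x.u and x.u^3 are
   nonzero multiples of u^3 and u, compatibility with x gives c1 = d3 g and
   d3 = c1 g, so g^2 = 1, whereas g^2 acts on u by -1. *)
From HB Require Import structures.
Require Import Defs.
From mathcomp Require Import all_boot all_order all_algebra all_field.
From mathcomp Require Import zify.
Import GRing.Theory.
Local Open Scope ring_scope.

Set Implicit Arguments.
Unset Strict Implicit.
Unset Printing Implicit Defensive.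

(** * Linear maps out of tensor products and Sweedler sums *)

Section TensorLift.
Variable K : fieldType.
Implicit Types V W : vectType K.

Lemma linear_comp (U1 U2 U3 : lmodType K) (F : U2 -> U3) (G : U1 -> U2) :
  linear F -> linear G -> linear (F \o G).
Proof. by move=> lF lG c u v; rewrite /= lG lF. Qed.

Lemma linear_hom (V W : vectType K) (f : 'Hom(V, W)) : linear f.
Proof. by move=> c u v; rewrite linearP. Qed.

Lemma linear_of_scalar (U1 U2 : lmodType K) (f : U1 -> K) (v : U2) :
  linear (f : U1 -> K^o) -> linear (fun u => f u *: v).
Proof. by move=> lf c a b; rewrite lf scalerDl scalerA. Qed.

(** The maps to which this and the next lemmas apply are unnamed expressions, so linearity is a
    hypothesis on a plain function, packed locally as a linear map. *)
Lemma linear_sum_of (U1 U2 : lmodType K) (F : U1 -> U2) I (r : seq I) (P : pred I)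
    (E : I -> U1) :
  linear F -> F (\sum_(i <- r | P i) E i) = \sum_(i <- r | P i) F (E i).
Proof.
move=> lF; pose FL : {linear U1 -> U2} :=
  HB.pack F (GRing.isLinear.Build K U1 U2 *:%R F lF).
by rewrite -[F]/(FL : U1 -> U2) linear_sum.
Qed.

Lemma linear_scale_of (U1 U2 : lmodType K) (F : U1 -> U2) (c : K) u :
  linear F -> F (c *: u) = c *: F u.
Proof.
move=> lF; pose FL : {linear U1 -> U2} :=
  HB.pack F (GRing.isLinear.Build K U1 U2 *:%R F lF).
by rewrite -[F]/(FL : U1 -> U2) linearZ.
Qed.

Lemma linear_add_of (U1 U2 : lmodType K) (F : U1 -> U2) u v :
  linear F -> F (u + v) = F u + F v.
Proof. by move=> lF; rewrite -[u]scale1r lF !scale1r. Qed.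

Lemma linear_opp_of (U1 U2 : lmodType K) (F : U1 -> U2) u :
  linear F -> F (- u) = - F u.
Proof. by move=> lF; rewrite -[- u]scaleN1r linear_scale_of // scaleN1r. Qed.

Lemma linear0_of (U1 U2 : lmodType K) (F : U1 -> U2) : linear F -> F 0 = 0.
Proof. by move=> lF; rewrite -[0](scale0r (0 : U1)) linear_scale_of // !scale0r. Qed.

Lemma eq_tlift V W (U : lmodType K) (f1 f2 : V -> W -> U) t :
  (forall v w, f1 v w = f2 v w) -> tlift f1 t = tlift f2 t.
Proof. by move=> e; apply: eq_bigr => i _; apply: eq_bigr => j _; rewrite e. Qed.

(** Complements [tlift_is_linear]: this is linearity in the bilinear map rather than in the tensor,
    for maps that depend on a parameter. *)
Lemma tlift_comb V W (U : lmodType K) (f1 f2 : V -> W -> U) c t :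
  tlift (fun v w => c *: f1 v w + f2 v w) t = c *: tlift f1 t + tlift f2 t.
Proof.
rewrite /tlift scaler_sumr -big_split /=; apply: eq_bigr => i _.
rewrite scaler_sumr -big_split /=; apply: eq_bigr => j _.
by rewrite scalerDr !scalerA mulrC.
Qed.

Lemma tlift_comp V W (U U' : lmodType K) (F : U -> U') (f : V -> W -> U) t :
  linear F -> F (tlift f t) = tlift (fun v w => F (f v w)) t.
Proof.
move=> lF; rewrite /tlift linear_sum_of //; apply: eq_bigr => i _.
by rewrite linear_sum_of //; apply: eq_bigr => j _; rewrite linear_scale_of.
Qed.

Lemma linear_tensl V W (w : W) : linear (fun v : V => tens v w).
Proof.
by move=> c u v; apply/matrixP => i j; rewrite !mxE linearP mulrDl mulrA.
Qed.

Lemma linear_tensr V W (v : V) : linear (fun w : W => tens v w).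
Proof.
move=> c u w; apply/matrixP => i j; rewrite !mxE linearP mulrDr.
by rewrite !mulrA [c * _]mulrC.
Qed.

Lemma eq_sweedler2 V (U : lmodType K) (D : V -> tensor V V)
    (f1 f2 : V -> V -> U) h :
  (forall a b, f1 a b = f2 a b) -> sweedler2 D f1 h = sweedler2 D f2 h.
Proof. exact: eq_tlift. Qed.

Lemma linear_sweedler2 V (U : lmodType K) (D : V -> tensor V V)
    (f : V -> V -> U) :
  linear D -> linear (sweedler2 D f).
Proof. by move=> lD c u v; rewrite /sweedler2 lD tlift_is_linear. Qed.

Lemma linear_sweedler2f V (U U' : lmodType K) (D : V -> tensor V V)
    (f : U' -> V -> V -> U) h :
  (forall a b, linear (fun p => f p a b)) ->
  linear (fun p => sweedler2 D (f p) h).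
Proof.
by move=> lf c u v; rewrite -tlift_comb; apply: eq_tlift => a b; rewrite lf.
Qed.

Lemma sweedler2_comp V (U U' : lmodType K) (D : V -> tensor V V)
    (F : U -> U') (f : V -> V -> U) h :
  linear F -> F (sweedler2 D f h) = sweedler2 D (fun a b => F (f a b)) h.
Proof. exact: tlift_comp. Qed.

Lemma eq_sweedler3 V (U : lmodType K) (D : V -> tensor V V)
    (f1 f2 : V -> V -> V -> U) h :
  (forall a b c, f1 a b c = f2 a b c) -> sweedler3 D f1 h = sweedler3 D f2 h.
Proof. by move=> e; apply: eq_sweedler2 => a h'; apply: eq_sweedler2. Qed.

Lemma linear_sweedler3 V (U : lmodType K) (D : V -> tensor V V)
    (f : V -> V -> V -> U) :
  linear D -> linear (sweedler3 D f).
Proof. exact: linear_sweedler2. Qed.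

Lemma linear_sweedler3f V (U U' : lmodType K) (D : V -> tensor V V)
    (f : U' -> V -> V -> V -> U) h :
  (forall a b c, linear (fun p => f p a b c)) ->
  linear (fun p => sweedler3 D (f p) h).
Proof.
by move=> lf; apply: linear_sweedler2f => a b; apply: linear_sweedler2f.
Qed.

Lemma sweedler3_comp V (U U' : lmodType K) (D : V -> tensor V V)
    (F : U -> U') (f : V -> V -> V -> U) h :
  linear F -> F (sweedler3 D f h) = sweedler3 D (fun a b c => F (f a b c)) h.
Proof.
move=> lF; rewrite /sweedler3 sweedler2_comp //.
by apply: eq_sweedler2 => a b; rewrite sweedler2_comp.
Qed.

Lemma sweedler3_grouplike V (U : lmodType K) (D : V -> tensor V V)
    (f : V -> V -> V -> U) h :
  linear D -> D h = tens h h ->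
  (forall b c, linear (fun a => f a b c)) ->
  (forall a c, linear (fun b => f a b c)) ->
  (forall a b, linear (f a b)) ->
  sweedler3 D f h = f h h h.
Proof.
move=> lD Dh l1 l2 l3; rewrite /sweedler3 {1}/sweedler2 Dh tlift_tens.
- by rewrite /sweedler2 Dh tlift_tens.
- by move=> w; apply: linear_sweedler2f.
- by move=> v; apply: linear_sweedler2.
Qed.

(** [V] is only a vector space, so a grouplike [e] stands in for the unit in Δ(x) = g ⊗ x + x ⊗
    1. *)
Lemma sweedler3_skew V (U : lmodType K) (D : V -> tensor V V)
    (f : V -> V -> V -> U) g e x :
  linear D -> D g = tens g g -> D e = tens e e ->
  D x = tens g x + tens x e ->
  (forall b c, linear (fun a => f a b c)) ->
  (forall a c, linear (fun b => f a b c)) ->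
  (forall a b, linear (f a b)) ->
  sweedler3 D f x = f g g x + f g x e + f x e e.
Proof.
move=> lD Dg De Dx l1 l2 l3.
have lin2 : forall v, linear (sweedler2 D (f v)) by move=> v; apply: linear_sweedler2.
have lin1 : forall w, linear (fun a => sweedler2 D (f a) w).
  by move=> w; apply: linear_sweedler2f.
rewrite /sweedler3 {1}/sweedler2 Dx (linear_add_of _ _ (tlift_is_linear _)).
rewrite !tlift_tens // /sweedler2 Dx (linear_add_of _ _ (tlift_is_linear _)).
by rewrite De !tlift_tens.
Qed.

End TensorLift.

(** * Interchange of Sweedler sums over two spaces *)

Section Exchange.
Variables (K : fieldType) (V W : vectType K) (U : lmodType K).

Lemma exchange_sweedler2 (D1 : V -> tensor V V) (D2 : W -> tensor W W)
    (f : V -> V -> W -> W -> U) v w :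
  sweedler2 D1 (fun v1 v2 => sweedler2 D2 (f v1 v2) w) v =
  sweedler2 D2 (fun w1 w2 => sweedler2 D1 (fun v1 v2 => f v1 v2 w1 w2) v) w.
Proof.
rewrite /sweedler2 /tlift.
(* Under the first sum over [v], the second one is moved inwards past both sums over [w]; the first
   sum then follows it. *)
under eq_bigr => i _.
  under eq_bigr => j _ do rewrite scaler_sumr.
  rewrite exchange_big /=; under eq_bigr => k _.
    under eq_bigr => j _ do rewrite scaler_sumr.
    rewrite exchange_big /=; over.
  over.
rewrite exchange_big; apply: eq_bigr => k _ /=.
rewrite exchange_big; apply: eq_bigr => l _ /=.
rewrite scaler_sumr; apply: eq_bigr => i _.
rewrite scaler_sumr; apply: eq_bigr => j _.
by rewrite !scalerA mulrC.
Qed.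

End Exchange.

(** In [drinfeld_mul_tens] the sum over q is outermost; moving it inside allows it to be evaluated
    for fixed a1, a2, a3. *)
Lemma exchange_sweedler3 (K : fieldType) (V W : vectType K) (U : lmodType K)
    (D1 : V -> tensor V V) (D2 : W -> tensor W W)
    (f : V -> V -> V -> W -> W -> W -> U) v w :
  sweedler3 D1 (fun v1 v2 v3 => sweedler3 D2 (f v1 v2 v3) w) v =
  sweedler3 D2
    (fun w1 w2 w3 => sweedler3 D1 (fun v1 v2 v3 => f v1 v2 v3 w1 w2 w3) v) w.
Proof.
rewrite /sweedler3.
under eq_sweedler2 => v1 v' do rewrite exchange_sweedler2.
rewrite exchange_sweedler2; apply: eq_sweedler2 => w1 w'.
under eq_sweedler2 => v1 v' do rewrite exchange_sweedler2.
by rewrite exchange_sweedler2.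
Qed.

(** * The dual space of H and contractions of its coproduct *)

Section Dual.
Variables (K : fieldType) (H : falgType K).
Implicit Types p q : dual H.

Lemma dual_ext p q : (forall h, pairing p h = pairing q h) -> p = q.
Proof. by move=> e; apply/lfunP. Qed.

Lemma linear_pairing q : linear (pairing q : H -> K^o).
Proof. exact: linear_hom. Qed.

Lemma pairing0 q : pairing q 0 = 0.
Proof. exact: (linear0_of (linear_pairing q)). Qed.

Lemma pairingD q a b : pairing q (a + b) = pairing q a + pairing q b.
Proof. exact: (linear_add_of _ _ (linear_pairing q)). Qed.

Lemma pairingN q a : pairing q (- a) = - pairing q a.
Proof. exact: (linear_opp_of _ (linear_pairing q)). Qed.

Lemma pairingZ q c a : pairing q (c *: a) = c * pairing q a.
Proof. exact: (linear_scale_of _ _ (linear_pairing q)). Qed.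

Lemma linear_pairing_dual h : linear ((fun q => pairing q h) : dual H -> K^o).
Proof. by move=> c p q; rewrite /pairing add_lfunE scale_lfunE. Qed.

Lemma pairing_sum I (r : seq I) (P : pred I) (E : I -> dual H) h :
  pairing (\sum_(i <- r | P i) E i) h = \sum_(i <- r | P i) pairing (E i) h.
Proof. exact: (linear_sum_of r P E (linear_pairing_dual h)). Qed.

Definition dual_linfun (f : H -> K^o) (lf : linear f) : dual H :=
  linfun (HB.pack f (GRing.isLinear.Build K H K^o *:%R f lf) : {linear H -> K^o}).

Lemma pairing_linfun (f : H -> K^o) (lf : linear f) h :
  pairing (dual_linfun lf) h = f h.
Proof. by rewrite /pairing lfunE. Qed.

Definition dual_basis (i : 'I_(\dim {:H})) : dual H :=
  linfun (coord (vbasis {:H}) i : H -> K^o).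

Lemma dual_basisE i h : pairing (dual_basis i) h = coord (vbasis {:H}) i h.
Proof. by rewrite /pairing lfunE. Qed.

Lemma dual_expand p :
  p = \sum_i pairing p (tnth (vbasis {:H}) i) *: dual_basis i.
Proof.
apply: dual_ext => h; rewrite pairing_sum /pairing {1}(coord_vbasis (memvf h)).
rewrite linear_sum; apply: eq_bigr => i _.
rewrite linearZ scale_lfunE [dual_basis i h]dual_basisE (tnth_nth 0).
exact: mulrC.
Qed.

Lemma pairing_sep a b : (forall p, pairing p a = pairing p b) -> a = b.
Proof.
move=> e; rewrite (coord_vbasis (memvf a)) (coord_vbasis (memvf b)).
by apply: eq_bigr => i _; rewrite -!dual_basisE e.
Qed.

(** Reflexivity in finite dimension: c is the sum of the f(e'_i) e_i over dual bases. This turns an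
    action of the dual into a coaction with coefficients in H. *)
Lemma linear_form_dual (f : dual H -> K^o) :
  linear f -> exists c, forall p, f p = pairing p c.
Proof.
move=> lf; exists (\sum_i (f (dual_basis i) : K) *: tnth (vbasis {:H}) i) => p.
rewrite [in LHS](dual_expand p) linear_sum_of // (linear_sum_of _ _ _ (linear_pairing p)).
apply: eq_bigr => i _; rewrite linear_scale_of //.
by rewrite pairingZ; exact: mulrC.
Qed.

Lemma linear_trans (a b : H) q : linear ((fun h => pairing q (a * h * b)) : H -> K^o).
Proof.
move=> c u v; rewrite mulrDr mulrDl -scalerAr -scalerAl.
exact: linear_pairing.
Qed.

(** In Sweedler notation this is <q1, a> <q3, b> q2, the form in which q enters the product of the
    double. *)
Definition dual_trans a b q : dual H := dual_linfun (linear_trans a b q).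

Lemma dual_transE a b q h : pairing (dual_trans a b q) h = pairing q (a * h * b).
Proof. exact: pairing_linfun. Qed.

Lemma linear_dual_trans a b : linear (dual_trans a b).
Proof.
move=> c p q; apply: dual_ext => h.
by rewrite (linear_pairing_dual h) !dual_transE (linear_pairing_dual (_ * _)).
Qed.

Lemma linear_dual_transl b q : linear (fun a => dual_trans a b q).
Proof.
move=> c u v; apply: dual_ext => h.
rewrite (linear_pairing_dual h) !dual_transE !mulrDl -!scalerAl.
exact: linear_pairing.
Qed.

Lemma linear_dual_transr a q : linear (fun b => dual_trans a b q).
Proof.
move=> c u v; apply: dual_ext => h.
rewrite (linear_pairing_dual h) !dual_transE mulrDr -scalerAr.
exact: linear_pairing.
Qed.

Lemma dual_trans11 q : dual_trans 1 1 q = q.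
Proof. by apply: dual_ext => h; rewrite dual_transE mul1r mulr1. Qed.

Lemma linear_dual_comul : linear (@dual_comul K H).
Proof.
move=> c p q; rewrite /dual_comul scaler_sumr -big_split /=; apply: eq_bigr => i _.
rewrite scaler_sumr -big_split /=; apply: eq_bigr => j _.
by rewrite (linear_pairing_dual (_ * _)) scalerDl scalerA.
Qed.

Lemma sweedler2_dual (U : lmodType K) (B : dual H -> dual H -> U) q :
  (forall w, linear (B^~ w)) -> (forall v, linear (B v)) ->
  let e := vbasis {:H} in
  sweedler2 (@dual_comul K H) B q =
  \sum_i \sum_j pairing q (tnth e i * tnth e j) *: B (dual_basis i) (dual_basis j).
Proof.
move=> l1 l2 /=; rewrite /sweedler2 /dual_comul.
rewrite (linear_sum_of _ _ _ (tlift_is_linear B)); apply: eq_bigr => i _.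
rewrite (linear_sum_of _ _ _ (tlift_is_linear B)); apply: eq_bigr => j _.
by rewrite (linear_scale_of _ _ (tlift_is_linear B)) tlift_tens.
Qed.

Lemma linear_scale_fun (U1 U2 : lmodType K) (F : U1 -> U2) (c : K) :
  linear F -> linear (fun u => c *: F u).
Proof. by move=> lF d u v; rewrite lF scalerDr !scalerA mulrC. Qed.

(** Expanding a in the basis, the sum over i of e'_i(a) q(e_i e_j) is q(a e_j), so contracting the
    first leg with a leaves the functional h |-> q(a h). *)
Lemma sweedler2_duall (U : lmodType K) (F : dual H -> U) a q :
  linear F ->
  sweedler2 (@dual_comul K H) (fun q1 q2 => pairing q1 a *: F q2) q
  = F (dual_trans a 1 q).
Proof.
move=> lF; rewrite sweedler2_dual; last 2 first.
- by move=> w; apply: linear_of_scalar; apply: linear_pairing_dual.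
- by move=> v; apply: linear_scale_fun.
rewrite [in RHS](dual_expand (dual_trans _ _ _)) linear_sum_of // exchange_big.
apply: eq_bigr => j _; rewrite linear_scale_of // dual_transE mulr1.
under eq_bigr do rewrite scalerA.
rewrite -scaler_suml; congr (_ *: _).
rewrite [in RHS](coord_vbasis (memvf a)) mulr_suml.
rewrite (linear_sum_of _ _ _ (linear_pairing q)); apply: eq_bigr => i _.
rewrite -scalerAl pairingZ dual_basisE (tnth_nth 0).
exact: mulrC.
Qed.

Lemma sweedler2_dualr (U : lmodType K) (F : dual H -> U) b q :
  linear F ->
  sweedler2 (@dual_comul K H) (fun q1 q2 => pairing q2 b *: F q1) q
  = F (dual_trans 1 b q).
Proof.
move=> lF; rewrite sweedler2_dual; last 2 first.
- by move=> w; apply: linear_scale_fun.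
- by move=> v; apply: linear_of_scalar; apply: linear_pairing_dual.
rewrite [in RHS](dual_expand (dual_trans _ _ _)) linear_sum_of //.
apply: eq_bigr => j _; rewrite linear_scale_of // dual_transE mul1r.
under eq_bigr do rewrite scalerA.
rewrite -scaler_suml; congr (_ *: _).
rewrite [in RHS](coord_vbasis (memvf b)) mulr_sumr.
rewrite (linear_sum_of _ _ _ (linear_pairing q)); apply: eq_bigr => i _.
rewrite -scalerAr pairingZ dual_basisE.
rewrite !(tnth_nth 0).
exact: mulrC.
Qed.

Lemma sweedler2_dual_pairing (U : lmodType K) (u : U) a b q :
  sweedler2 (@dual_comul K H) (fun q1 q2 => (pairing q1 a * pairing q2 b) *: u) q
  = pairing q (a * b) *: u.
Proof.
under eq_sweedler2 do rewrite -scalerA.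
rewrite (sweedler2_duall _ _ (F := fun q2 => pairing q2 b *: u)).
  by rewrite dual_transE mulr1.
by apply: linear_of_scalar; apply: linear_pairing_dual.
Qed.

(** The inner coproduct is contracted on the right with b, then the outer one on the left with a. *)
Lemma sweedler3_dual (U : lmodType K) (F : dual H -> U) a b q :
  linear F ->
  sweedler3 (@dual_comul K H)
    (fun q1 q2 q3 => (pairing q1 a * pairing q3 b) *: F q2) q
  = F (dual_trans a b q).
Proof.
move=> lF; rewrite /sweedler3.
under eq_sweedler2 => q1 q'.
  under eq_sweedler2 do rewrite -scalerA.
  rewrite -(sweedler2_comp _ _ _ (F := fun u => pairing q1 a *: u)); last first.
    by move=> c u v; rewrite scalerDr !scalerA mulrC.
  rewrite sweedler2_dualr //; over.
rewrite (sweedler2_duall _ _ (F := fun q' => F (dual_trans 1 b q'))).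
  by congr F; apply: dual_ext => h; rewrite !dual_transE mul1r mulr1 mulrA.
by apply: (linear_comp lF); apply: linear_dual_trans.
Qed.

End Dual.

(** * The convolution product on the dual and the product of the Drinfeld double *)

Section Double.
Variables (K : fieldType) (H : falgType K) (S : hopf_struct H).
Implicit Types p q : dual H.
Local Notation eps := (counit S : dual H).
Local Notation D := (comul S : H -> tensor H H).
Local Notation Sinv := ((antipode S)^-1%VF).

Lemma linear_dual_mull q : linear (dual_mul S ^~ q).
Proof.
move=> c u v; apply: dual_ext => h.
rewrite (linear_pairing_dual h) !dual_mulE.
rewrite -(linear_sweedler2f D _ (f := fun p a b => pairing p a * pairing q b : K^o)) //.
by move=> a b d p p'; rewrite (linear_pairing_dual a) mulrDl scalerAl.
Qed.

Lemma linear_dual_mulr p : linear (dual_mul S p).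
Proof.
move=> c u v; apply: dual_ext => h.
rewrite (linear_pairing_dual h) !dual_mulE.
rewrite -(linear_sweedler2f D _ (f := fun q a b => pairing p a * pairing q b : K^o)) //.
by move=> a b d q q'; rewrite (linear_pairing_dual b) mulrDr scalerAr.
Qed.

Lemma dual_mul1l q : dual_mul S eps q = q.
Proof.
apply: dual_ext => h; rewrite dual_mulE -{2}(counitl S h).
rewrite (sweedler2_comp _ _ _ (linear_pairing q)).
by apply: (@eq_sweedler2 _ _ K^o) => a b; rewrite pairingZ.
Qed.

Lemma dual_mul1r p : dual_mul S p eps = p.
Proof.
apply: dual_ext => h; rewrite dual_mulE -{2}(counitr S h).
rewrite (sweedler2_comp _ _ _ (linear_pairing p)).
apply: (@eq_sweedler2 _ _ K^o) => a b; rewrite pairingZ.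
exact: mulrC.
Qed.

Lemma linear_drinfeld_mul_tens1 a q b :
  linear (fun p => drinfeld_mul_tens S p a q b).
Proof.
apply: linear_sweedler3f => q1 q2 q3; apply: linear_sweedler3f => a1 a2 a3.
apply: linear_scale_fun => c u v.
by rewrite linear_dual_mull; apply: (linear_tensl (_ * _)).
Qed.

Lemma linear_drinfeld_mul_tens2 p q b :
  linear (fun a => drinfeld_mul_tens S p a q b).
Proof.
apply: linear_sweedler3f => q1 q2 q3; apply: linear_sweedler3.
exact: linear_hom.
Qed.

Lemma linear_drinfeld_mul_tens3 p a b :
  linear (fun q => drinfeld_mul_tens S p a q b).
Proof. by apply: linear_sweedler3; apply: linear_dual_comul. Qed.

Lemma linear_drinfeld_mul_tens4 p a q : linear (drinfeld_mul_tens S p a q).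
Proof.
apply: linear_sweedler3f => q1 q2 q3; apply: linear_sweedler3f => a1 a2 a3.
apply: linear_scale_fun => c u v.
by rewrite mulrDr -scalerAr; apply: (linear_tensr (dual_mul S p q2)).
Qed.

Lemma drinfeld_mulE p a q b :
  drinfeld_mul S (tens p a) (tens q b) = drinfeld_mul_tens S p a q b.
Proof.
have l q' b' : (forall w, linear (drinfeld_mul_tens S q' b' ^~ w)) /\
    (forall v, linear (drinfeld_mul_tens S q' b' v)).
  by split=> ?; [apply: linear_drinfeld_mul_tens3|apply: linear_drinfeld_mul_tens4].
rewrite /drinfeld_mul tlift_tens.
- by rewrite tlift_tens //; case: (l p a).
- move=> w c u v; rewrite -tlift_comb; apply: eq_tlift => q' b'.
  exact: linear_drinfeld_mul_tens1.
- move=> w c u v; rewrite -tlift_comb; apply: eq_tlift => q' b'.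
  exact: linear_drinfeld_mul_tens2.
Qed.

(** * Actions of the double as compatible actions of H and of its dual *)

Section Action.
Variables (A : algType K) (act : drinfeld_double H -> A -> A).
Hypothesis actP : module_algebra (drinfeld_ops S) act.

Definition dact q v := act (tens q 1) v.
Definition hact (h : H) v := act (tens eps h) v.

Lemma linear_act_tensr q v : linear (fun h => act (tens q h) v).
Proof. exact: (linear_comp (act_linl actP v) (linear_tensr q)). Qed.

Lemma linear_act_tensl h v : linear (fun q : dual H => act (tens q h) v).
Proof. exact: (linear_comp (act_linl actP v) (linear_tensl h)). Qed.

Lemma linear_dact v : linear (dact^~ v).
Proof. exact: linear_act_tensl. Qed.

Lemma linear_dactr q : linear (dact q).
Proof. exact: (act_linr actP). Qed.

Lemma act_mulE p a q b v :
  act (tens p a) (act (tens q b) v) = act (drinfeld_mul_tens S p a q b) v.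
Proof. by rewrite -(actM actP) /= drinfeld_mulE. Qed.

Lemma comul_linear : linear D. Proof. exact: linear_hom. Qed.

(** Once the sums are exchanged, the one over q collapses to the single functional h |-> q(S^-1(a3)
    h a1), and only the iterated coproduct of a remains to be computed. *)
Lemma act_drinfeld_mul p a q b v :
  act (drinfeld_mul_tens S p a q b) v =
  sweedler3 D (fun a1 a2 a3 =>
    act (tens (dual_mul S p (dual_trans (Sinv a3) a1 q)) (a2 * b)) v) a.
Proof.
rewrite /drinfeld_mul_tens exchange_sweedler3 (sweedler3_comp _ _ _ (act_linl actP v)).
apply: eq_sweedler3 => a1 a2 a3.
rewrite (sweedler3_dual _ _ _ (F := fun q2 => tens (dual_mul S p q2) (a2 * b))) //.
exact: (linear_comp (linear_tensl (a2 * b)) (linear_dual_mulr p)).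
Qed.

Lemma linear_act_trans1 p q b v h2 h3 :
  linear (fun h1 => act (tens (dual_mul S p (dual_trans h3 h1 q)) (h2 * b)) v).
Proof.
apply: (linear_comp (linear_act_tensl _ v)).
exact: (linear_comp (linear_dual_mulr p) (linear_dual_transr _ q)).
Qed.

Lemma linear_act_trans2 p q b v h1 h3 :
  linear (fun h2 => act (tens (dual_mul S p (dual_trans h3 h1 q)) (h2 * b)) v).
Proof.
move=> c u w; rewrite mulrDl -scalerAl; exact: linear_act_tensr.
Qed.

Lemma linear_act_trans3 p q b v h1 h2 :
  linear (fun h3 =>
    act (tens (dual_mul S p (dual_trans (Sinv h3) h1 q)) (h2 * b)) v).
Proof.
apply: (linear_comp (linear_act_tensl _ v)).
apply: (linear_comp (linear_dual_mulr p)).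
exact: (linear_comp (linear_dual_transl h1 q) (linear_hom Sinv)).
Qed.

(* Needed to evaluate _^-1%VF, which is only a one-sided inverse in general. *)
Hypothesis Sinj : lker (antipode S) = 0%VS.

(** For grouplike h the antipode axiom reads h S(h) = 1; multiplying by the left inverse k gives
    S(h) = k. *)
Lemma antipode_grouplike h k : D h = tens h h -> counit S h = 1 ->
  k * h = 1 -> antipode S h = k.
Proof.
move=> Dh eh kh; have := antipoder S h; rewrite /sweedler2 Dh tlift_tens.
- by rewrite eh scale1r => hSh; rewrite -[LHS]mul1r -kh -mulrA hSh mulr1.
- by move=> w c u v; rewrite mulrDl scalerAl.
- by move=> w c u v; rewrite linearP mulrDr scalerAr.
Qed.

Lemma antipode1 : antipode S 1 = 1.
Proof.
have := antipodel S 1; rewrite /sweedler2 comul1 tlift_tens ?mulr1 ?counit1 ?scale1r //.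
- by move=> w c u v; rewrite linearP mulrDl scalerAl.
- by move=> w c u v; rewrite mulrDr scalerAr.
Qed.

Lemma Sinv1 : Sinv 1 = 1.
Proof. by rewrite -{1}antipode1 lker0_lfunK // Sinj. Qed.

(** In the double (p ⊗ 1)(ε ⊗ b) = p ⊗ b, since 1 is grouplike and ε is the unit of the dual. *)
Lemma act_tensE p b v : act (tens p b) v = dact p (hact b v).
Proof.
rewrite /dact /hact act_mulE act_drinfeld_mul (sweedler3_grouplike (h := 1)).
- by rewrite Sinv1 dual_trans11 dual_mul1r mul1r.
- exact: comul_linear.
- exact: comul1.
- by move=> *; apply: linear_act_trans1.
- by move=> *; apply: linear_act_trans2.
- by move=> *; apply: linear_act_trans3.
Qed.

Lemma dactM p q v : dact (dual_mul S p q) v = dact p (dact q v).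
Proof.
rewrite /dact act_mulE act_drinfeld_mul (sweedler3_grouplike (h := 1)).
- by rewrite Sinv1 dual_trans11 mulr1.
- exact: comul_linear.
- exact: comul1.
- by move=> *; apply: linear_act_trans1.
- by move=> *; apply: linear_act_trans2.
- by move=> *; apply: linear_act_trans3.
Qed.

(** The iterated coproduct of h is h ⊗ h ⊗ h, so (ε ⊗ h)(q ⊗ 1) = q(S^-1(h) - h) ⊗ h. For h = g this
    is the Yetter-Drinfeld compatibility with g. *)
Lemma hact_dact_grouplike h q v : D h = tens h h ->
  hact h (dact q v) = dact (dual_trans (Sinv h) h q) (hact h v).
Proof.
move=> Dh; rewrite -act_tensE /hact /dact act_mulE act_drinfeld_mul.
rewrite (sweedler3_grouplike (h := h)).
- by rewrite dual_mul1l mulr1.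
- exact: comul_linear.
- by [].
- by move=> *; apply: linear_act_trans1.
- by move=> *; apply: linear_act_trans2.
- by move=> *; apply: linear_act_trans3.
Qed.

(** The three terms come from the iterated coproduct g ⊗ g ⊗ x + g ⊗ x ⊗ 1 + x ⊗ 1 ⊗ 1, whose outer
    legs act on q and whose middle leg acts on v. *)
Lemma hact_dact_skew g x q v : D g = tens g g -> D x = tens g x + tens x 1 ->
  hact x (dact q v) =
    dact (dual_trans (Sinv x) g q) (hact g v) + dact (dual_trans 1 g q) (hact x v)
    + dact (dual_trans 1 x q) v.
Proof.
move=> Dg Dx; rewrite -!act_tensE {1}/hact {1}/dact act_mulE act_drinfeld_mul.
rewrite (sweedler3_skew (g := g) (e := 1) (x := x)).
- by rewrite !dual_mul1l !mulr1 Sinv1.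
- exact: comul_linear.
- by [].
- exact: comul1.
- by [].
- by move=> *; apply: linear_act_trans1.
- by move=> *; apply: linear_act_trans2.
- by move=> *; apply: linear_act_trans3.
Qed.

Lemma drinfeld_comul_dual p :
  drinfeld_comul S (tens p 1) =
  sweedler2 (@dual_comul K H) (fun p1 p2 =>
    tens (tens p2 1 : drinfeld_double H) (tens p1 1 : drinfeld_double H)) p.
Proof.
have l1 p1 p2 b : linear (fun a : H => tens (tens p2 a : drinfeld_double H)
                                   (tens p1 b : drinfeld_double H)).
  exact: (linear_comp (linear_tensl _) (linear_tensr p2)).
have l2 p1 p2 a : linear (fun b : H => tens (tens p2 a : drinfeld_double H)
                                   (tens p1 b : drinfeld_double H)).
  exact: (linear_comp (linear_tensr _) (linear_tensr p1)).
rewrite /drinfeld_comul tlift_tens.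
- by apply: eq_sweedler2 => p1 p2; rewrite /sweedler2 comul1 tlift_tens.
- by move=> h; apply: linear_sweedler2; apply: linear_dual_comul.
- move=> q; apply: linear_sweedler2f => p1 p2.
  by apply: linear_sweedler2; apply: comul_linear.
Qed.

(** The legs of p appear in reversed order because the double carries the co-opposite coproduct on
    the dual. *)
Lemma dact_mul p a b :
  dact p (a * b) = sweedler2 (@dual_comul K H) (fun p1 p2 => dact p2 a * dact p1 b) p.
Proof.
rewrite /dact (act_mul actP) /= /sweedler2 drinfeld_comul_dual.
rewrite (sweedler2_comp _ _ _ (tlift_is_linear _)).
apply: eq_sweedler2 => p1 p2; rewrite tlift_tens //.
- by move=> w c u v; rewrite (act_linl actP) mulrDl scalerAl.
- by move=> w c u v; rewrite (act_linl actP) mulrDr scalerAr.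
Qed.

Lemma dact_one p : dact p 1 = pairing p 1 *: 1.
Proof.
rewrite /dact (act_one actP) /= /drinfeld_counit tlift_tens.
- by rewrite counit1 mulr1.
- move=> w c u v; rewrite (linear_pairing_dual 1) mulrDl.
  by rewrite scalerAl.
- by move=> w c u v; rewrite linearP mulrDr scalerAr.
Qed.

End Action.
End Double.

Lemma span_ind (K : fieldType) (V : vectType K) (X : seq V) (P : V -> Prop) :
  P 0 -> (forall c u v, P u -> P v -> P (c *: u + v)) ->
  (forall v, v \in X -> P v) -> forall v, v \in <<X>>%VS -> P v.
Proof.
move=> P0 Plin PX v /(coord_span (X := in_tuple X)) ->.
elim/big_rec: _ => // i w _ Pw; apply: Plin => //.
by apply: PX; apply: mem_nth.
Qed.

Lemma eq_oppr_eq0 (K : fieldType) (V : lmodType K) (v : V) :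
  2%:R != 0 :> K -> v = - v -> v = 0.
Proof.
move=> two_neq0 e; have : 2%:R *: v == 0 by rewrite scaler_nat mulr2n {1}e addNr.
by rewrite scaler_eq0 (negPf two_neq0) => /eqP.
Qed.

(** * Structure of T(4,2,1): normal forms, the centralizer of g, the antipode *)

Section T421.
Variables (K : fieldType) (H : falgType K) (S : hopf_struct H) (g x : H).
Hypothesis HT : is_T421 S g x.
Local Notation D := (comul S : H -> tensor H H).

Lemma T421_g4 : g ^+ 4 = 1. Proof. by case: (T421_relP HT). Qed.

Lemma eq_gX m n : (m %% 4 = n %% 4)%N -> g ^+ m = g ^+ n.
Proof. by move=> e; rewrite -(expr_mod m T421_g4) e expr_mod // T421_g4. Qed.

Lemma T421_xx : x * x = g ^+ 2 - 1.
Proof. by rewrite -expr2; case: (T421_relP HT). Qed.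

Lemma T421_gx : g * x = - (x * g). Proof. by case: (T421_relP HT). Qed.

Lemma T421_xgX n : x * g ^+ n = (-1) ^+ n *: (g ^+ n * x).
Proof.
elim: n => [|n IHn]; first by rewrite mulr1 mul1r scale1r.
have xg : x * g = - (g * x) by rewrite T421_gx opprK.
rewrite [in LHS]exprSr mulrA IHn -scalerAl -(mulrA _ x) xg mulrN mulrA -exprSr.
by rewrite scalerN -scaleNr [(-1) ^+ n.+1]exprS mulN1r.
Qed.

(** The g^i x^j with i < 4 and j < 2 span H: their span contains 1 and is stable under left
    multiplication by g and by x, because x g^i = (-1)^i g^i x and x^2 = g^2 - 1. *)
Lemma T421_ind (P : H -> Prop) :
  P 0 -> (forall c u v, P u -> P v -> P (c *: u + v)) ->
  (forall n, P (g ^+ n)) -> (forall n, P (g ^+ n * x)) -> forall h, P h.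
Proof.
move=> P0 Plin Pg Pgx h.
pose X := [seq g ^+ (i : 'I_4) * x ^+ (j : 'I_2) | i <- enum 'I_4, j <- enum 'I_2].
have XM i j : (j < 2)%N -> g ^+ i * x ^+ j \in <<X>>%VS.
  move=> j2; rewrite -(expr_mod i T421_g4); apply: memv_span.
  have i4 : (i %% 4 < 4)%N by rewrite ltn_mod.
  by apply/allpairsP; exists (Ordinal i4, Ordinal j2); rewrite !mem_enum.
have : h \in agenv <<[:: g; x]>>%VS by rewrite (T421_gen HT) memvf.
have sM : (agenv <<[:: g; x]>> <= <<X>>)%VS.
  apply: agenv_sub_modl; first by rewrite -memvE -[1]mulr1; apply: (XM 0 0)%N.
  apply/prodvP => a b aU.
  move: b; apply: span_ind => [|c b1 b2 h1 h2|b].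
  - by rewrite mulr0 mem0v.
  - by rewrite mulrDr -scalerAr memvD // memvZ.
  case/allpairsP => -[i j] /= [_ _ ->]; move: a aU.
  apply: span_ind => [|c a1 a2 h1 h2|a].
  - by rewrite mul0r mem0v.
  - by rewrite mulrDl -scalerAl memvD // memvZ.
  rewrite !inE => /orP[] /eqP ->; first by rewrite mulrA -exprS XM.
  rewrite mulrA T421_xgX -scalerAl memvZ // -mulrA -exprS.
  case: j => -[|[|//]] _ /=; first by rewrite XM.
  rewrite expr2 T421_xx mulrBr mulr1 -exprD memvB //.
    by have := XM (i + 2)%N 0%N isT; rewrite mulr1.
  by have := XM i 0%N isT; rewrite mulr1.
move/(subvP sM); apply: span_ind => // v /allpairsP[[i j] /= [_ _ ->]].
by case: j => -[|[|//]] _ /=; rewrite ?mulr1.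
Qed.

Definition gspan : {vspace H} := <<[seq (g ^+ (i : 'I_4))%R | i <- enum 'I_4]>>%VS.

Lemma gspanX n : g ^+ n \in gspan.
Proof.
rewrite -(expr_mod n T421_g4); apply: memv_span.
have n4 : (n %% 4 < 4)%N by rewrite ltn_mod.
by apply/mapP; exists (Ordinal n4); rewrite // mem_enum.
Qed.

Lemma gspan_ind (P : H -> Prop) :
  P 0 -> (forall c u v, P u -> P v -> P (c *: u + v)) ->
  (forall n, P (g ^+ n)) -> forall h, h \in gspan -> P h.
Proof.
by move=> P0 Plin PX; apply: span_ind => // v /mapP[i _ ->].
Qed.

Lemma T421_decomp h : exists a b, [/\ a \in gspan, b \in gspan & h = a + b * x].
Proof.
move: h; apply: T421_ind => [|c u v [a [b [ha hb ->]]] [a' [b' [ha' hb' ->]]]|n|n].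
- by exists 0, 0; rewrite !mem0v mul0r addr0.
- exists (c *: a + a'), (c *: b + b'); rewrite !memvD ?memvZ //; split=> //.
  by rewrite scalerDr mulrDl scalerAl addrACA.
- by exists (g ^+ n), 0; rewrite gspanX mem0v mul0r addr0.
- by exists 0, (g ^+ n); rewrite gspanX mem0v add0r.
Qed.

Lemma gspan_comm h a : g * h = h * g -> a \in gspan -> a * h = h * a.
Proof.
move=> gh; move: a; apply: gspan_ind => [|c u v hu hv|n].
- by rewrite mul0r mulr0.
- by rewrite mulrDl mulrDr -scalerAl -scalerAr hu hv.
- by apply/esym; apply: commrX.
Qed.

(** Write h = a + b x with a, b in [gspan]. The part b x anticommutes with g, so if h commutes with
    g then g b x is its own opposite, hence zero, and g is invertible. *)
Lemma comm_gspan h : 2%:R != 0 :> K -> g * h = h * g -> h \in gspan.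
Proof.
move=> two_neq0.
have [a [b [ha hb ->]]] := T421_decomp h => e.
have {e} : g * (b * x) = - (g * (b * x)).
  apply: (addrI (g * a)); rewrite -mulrDr e mulrDl (gspan_comm _ ha) //; congr (_ + _).
  by rewrite (mulrA g) -(gspan_comm (erefl (g * g)) hb) -!mulrA T421_gx mulrN opprK.
move/(eq_oppr_eq0 two_neq0)/(congr1 (fun h => g ^+ 3 * h)).
by rewrite mulrA -exprSr T421_g4 mul1r mulr0 => ->; rewrite addr0.
Qed.

Lemma g2_central h : g ^+ 2 * h = h * g ^+ 2.
Proof.
have [a [b [ha hb ->]]] := T421_decomp h.
have gg : g * g ^+ 2 = g ^+ 2 * g by rewrite -exprS -exprSr.
rewrite mulrDr mulrDl (gspan_comm gg ha) mulrA -(gspan_comm gg hb) -!mulrA T421_xgX.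
by rewrite sqrrN expr1n scale1r expr2 -!mulrA.
Qed.

Lemma tmul_tens (s1 s2 t1 t2 : H) :
  tmul *%R *%R (tens s1 s2) (tens t1 t2) = tens (s1 * t1) (s2 * t2).
Proof.
rewrite /tmul tlift_tens.
- rewrite tlift_tens // => w c u v.
    by rewrite mulrDr -scalerAr (linear_tensl (s2 * w)).
  by rewrite mulrDr -scalerAr (linear_tensr (s1 * w)).
- move=> w c u v; rewrite -tlift_comb; apply: eq_tlift => a b.
  by rewrite mulrDl -scalerAl (linear_tensl (w * b)).
- move=> w c u v; rewrite -tlift_comb; apply: eq_tlift => a b.
  by rewrite mulrDl -scalerAl (linear_tensr (w * a)).
Qed.

Lemma comul_gX n : D (g ^+ n) = tens (g ^+ n) (g ^+ n).
Proof.
elim: n => [|n IHn]; first exact: comul1.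
by rewrite !exprS comulM (T421_comul_g HT) IHn tmul_tens.
Qed.

Lemma counit_gX n : counit S (g ^+ n) = 1.
Proof.
elim: n => [|n IHn]; first exact: counit1.
by rewrite exprS counitM IHn (T421_counit_g HT) mulr1.
Qed.

(** The counit is multiplicative, so ε(x)^2 = ε(g^2 - 1) = 0. *)
Lemma counit_x : counit S x = 0.
Proof.
have := counitM S x x; rewrite T421_xx linearB /= counit_gX counit1 subrr.
by move/esym/eqP; rewrite mulf_eq0 => /orP[] /eqP.
Qed.

Lemma comul_gXx n :
  D (g ^+ n * x) = tens (g ^+ n.+1) (g ^+ n * x) + tens (g ^+ n * x) (g ^+ n).
Proof.
rewrite comulM comul_gX (T421_comul_x HT).
have l s : linear (tmul *%R *%R s : tensor H H -> tensor H H).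
  move=> c u v; rewrite /tmul -tlift_comb; apply: eq_tlift => a b.
  exact: tlift_is_linear.
by rewrite linear_add_of // !tmul_tens mulr1 -exprSr.
Qed.

Lemma antipode_gX n : antipode S (g ^+ n) = g ^+ (3 * n).
Proof.
apply: antipode_grouplike; rewrite ?comul_gX ?counit_gX //.
by rewrite -exprD -mulSnr exprM T421_g4 expr1n.
Qed.

(* The coproduct of g^n x and the antipode axiom give
   S(g^(n+1)) g^n x + S(g^n x) g^n = 0. *)
Lemma antipode_gXx n :
  antipode S (g ^+ n * x) = - (-1) ^+ (3 * n) *: (g ^+ (3 * n).+3 * x).
Proof.
have := antipodel S (g ^+ n * x).
rewrite /sweedler2 comul_gXx (linear_add_of _ _ (tlift_is_linear _)).
have l1 w : linear (fun v => antipode S v * w).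
  by move=> c u v; rewrite linearP mulrDl scalerAl.
have l2 v : linear (fun w => antipode S v * w).
  by move=> c u w; rewrite mulrDr scalerAr.
rewrite !tlift_tens // counitM counit_x mulr0 scale0r antipode_gX.
move/eqP; rewrite addrC addr_eq0 => /eqP /(congr1 (fun h => h * g ^+ (3 * n))).
rewrite -mulrA -exprD -mulSn exprM T421_g4 expr1n mulr1 => ->.
rewrite mulNr mulrA -exprD -mulrA T421_xgX -scalerAr scaleNr; congr (- (_ *: _)).
rewrite mulrA -exprD; congr (_ * _).
by apply: eq_gX; lia.
Qed.

(** By the dimension formula surjectivity suffices, and it is checked on the spanning elements g^n
    and g^n x. *)
Lemma antipode_inj : lker (antipode S) = 0%VS.
Proof.
have sur : limg (antipode S) = {:H}%VS.
  apply/eqP; rewrite eqEsubv subvf; apply/subvP => h _; move: h.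
  apply: T421_ind => [|c u v hu hv|n|n].
  - exact: mem0v.
  - by rewrite memvD // memvZ.
  - suff -> : g ^+ n = antipode S (g ^+ (3 * n)) by rewrite memv_img ?memvf.
    by rewrite antipode_gX; apply: eq_gX; lia.
  (* Up to sign S(g^m x) is g^(3m+3) x, and m = 3n+3 solves 3m+3 = n modulo 4. *)
  - have := antipode_gXx (3 * n).+3; set m := (3 * (3 * n).+3)%N => e.
    rewrite -(memvN _ (_ * _)) -(signrZK m (- _)).
    rewrite memvZ //.
    have -> : (-1) ^+ m *: - (g ^+ n * x) = antipode S (g ^+ (3 * n).+3 * x).
      rewrite e scalerN scaleNr; congr (- (_ *: (_ * x))).
      by apply: eq_gX; rewrite /m; lia.
    by rewrite memv_img ?memvf.
apply/eqP; rewrite -dimv_eq0; have := limg_ker_dim (antipode S) {:H}%VS.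
by rewrite sur capfv => /eqP; rewrite -[X in _ == X]add0n eqn_add2r.
Qed.

Lemma Sinv_g : ((antipode S)^-1)%VF g = g ^+ 3.
Proof.
have {1}-> : g = antipode S (g ^+ 3).
  by rewrite antipode_gX -[LHS]expr1; apply: eq_gX.
by rewrite lker0_lfunK ?antipode_inj.
Qed.

(** At the grouplike g^n the convolution product is p(g^n) q(g^n), and conjugation by g fixes
    g^n. *)
Lemma dual_mul_conj_gspan p q c : c \in gspan ->
  pairing (dual_mul S (dual_trans (g ^+ 3) g p) q) c = pairing (dual_mul S p q) c.
Proof.
move: c; apply: gspan_ind => [|d u v hu hv|n].
- by rewrite !pairing0.
- by rewrite !pairingD !pairingZ hu hv.
have bil (r : dual H) : (forall w, linear (fun v => pairing r v * pairing q w : K^o)) /\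
   (forall v, linear (fun w => pairing r v * pairing q w : K^o)).
  split=> w c u v; first by rewrite (linear_pairing r) mulrDl scalerAl.
  by rewrite (linear_pairing q) mulrDr scalerAr.
rewrite !dual_mulE /sweedler2 comul_gX.
rewrite !tlift_tens; try by case: (bil p) => ? ?; case: (bil (dual_trans (g ^+ 3) g p)).
by rewrite dual_transE -exprD -exprSr (@eq_gX (3 + n).+1 n) //; lia.
Qed.

End T421.

(** * The coaction on A and the contradiction *)

Section Obstruction.
Variables (K : fieldType) (H : falgType K) (S : hopf_struct H) (g x : H).
Hypothesis HT : is_T421 S g x.
(** The algebra is described abstractly by u with u^4 = 1 and by the coordinates [lam j] in the
    basis 1, u, u^2, u^3. *)
Variables (zeta : K) (A : algType K) (u : A) (lam : nat -> A -> K).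
Hypothesis zetaP : 4.-primitive_root zeta.
Hypothesis two_neq0 : 2%:R != 0 :> K.
Hypothesis u4 : u ^+ 4 = 1.
Hypothesis lam_lin : forall j, linear (lam j : A -> K^o).
Hypothesis lam_basis : forall a, a = \sum_(j < 4) lam j a *: u ^+ j.
Hypothesis lamX : forall i j, (i < 4)%N -> (j < 4)%N -> lam i (u ^+ j) = (i == j)%:R.
Variables (act : H -> A -> A) (act' : drinfeld_double H -> A -> A).
Hypothesis actP : module_algebra (hopf_ops S) act.
Hypothesis act_g : act g u = zeta *: u.
Hypothesis actP' : module_algebra (drinfeld_ops S) act'.
Hypothesis act_ext : forall h a, act' (drinfeld_incl S h) a = act h a.
Implicit Types (p q : dual H) (a b : A).
Local Notation T := (dact act').

Lemma hactE h a : hact S act' h a = act h a.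
Proof. exact: act_ext. Qed.

Lemma lamZ j c a : lam j (c *: a) = c * lam j a.
Proof. exact: (linear_scale_of _ _ (lam_lin j)). Qed.

Lemma lamD j a b : lam j (a + b) = lam j a + lam j b.
Proof. exact: (linear_add_of _ _ (lam_lin j)). Qed.

Lemma zeta2 : zeta ^+ 2 = -1.
Proof.
have := prim_expr_order zetaP; rewrite (exprM zeta 2 2) => /eqP.
rewrite sqrf_eq1 => /orP[|/eqP //].
by rewrite -[1](expr0 zeta) (eq_prim_root_expr zetaP).
Qed.

Lemma zeta_neq0 : zeta != 0.
Proof.
apply/eqP => z0; have := zeta2; rewrite z0 expr0n /= => /esym/eqP.
by rewrite oppr_eq0 oner_eq0.
Qed.

Lemma act_g_mul a b : act g (a * b) = act g a * act g b.
Proof.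
rewrite (act_mul actP) /= /sweedler2 (T421_comul_g HT) tlift_tens //.
- by move=> w c v1 v2; rewrite (act_linl actP) mulrDl scalerAl.
- by move=> w c v1 v2; rewrite (act_linl actP) mulrDr scalerAr.
Qed.

Lemma act_gX j : act g (u ^+ j) = zeta ^+ j *: u ^+ j.
Proof.
elim: j => [|j IHj].
  by rewrite (act_one actP) /= (T421_counit_g HT).
by rewrite !exprS act_g_mul act_g IHj -scalerAl -scalerAr scalerA.
Qed.

Lemma lam_act_g j a : (j < 4)%N -> lam j (act g a) = zeta ^+ j * lam j a.
Proof.
move=> j4; rewrite {1}(lam_basis a) (linear_sum_of _ _ _ (act_linr actP g)).
rewrite (linear_sum_of _ _ _ (lam_lin j)) (bigD1 (Ordinal j4)) //= big1.
  by rewrite addr0 (linear_scale_of _ _ (act_linr actP g)) act_gX !lamZ lamX // eqxx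
    mulr1 mulrC.
move=> i ni; rewrite (linear_scale_of _ _ (act_linr actP g)) act_gX !lamZ lamX //.
by rewrite eq_sym -[j]/(nat_of_ord (Ordinal j4)) (inj_eq val_inj) (negPf ni) !mulr0.
Qed.

(** The powers zeta^0, ..., zeta^3 are distinct, so each eigenspace of g is a line spanned by a
    power of u. *)
Lemma eigen_u k a : (k < 4)%N -> act g a = zeta ^+ k *: a -> a = lam k a *: u ^+ k.
Proof.
move=> k4 e; rewrite {1}(lam_basis a) (bigD1 (Ordinal k4)) //= big1 ?addr0 // => i ni.
have := lam_act_g a (ltn_ord i); rewrite e lamZ => /eqP.
rewrite -subr_eq0 -mulrBl mulf_eq0 subr_eq0 (eq_prim_root_expr zetaP).
rewrite !modn_small // => /orP[/eqP ki|/eqP ->]; last by rewrite scale0r.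
by case/eqP: ni; apply: val_inj.
Qed.

Lemma act_gx a : act g (act x a) = - act x (act g a).
Proof.
by rewrite -!(actM actP) /= (T421_gx HT) (linear_opp_of _ (act_linl actP a)).
Qed.

Lemma zeta3 : zeta ^+ 3 = - zeta.
Proof. by rewrite exprS zeta2 mulrN1. Qed.

(** As x anticommutes with g, it sends the eigenvalue zeta to - zeta = zeta^3. *)
Lemma act_x_u : act x u = lam 3 (act x u) *: u ^+ 3.
Proof.
apply: eigen_u => //; rewrite act_gx act_g zeta3.
by rewrite (linear_scale_of _ _ (act_linr actP x)) scaleNr.
Qed.

Lemma act_x_u3 : act x (u ^+ 3) = lam 1 (act x (u ^+ 3)) *: u.
Proof.
rewrite -[u in RHS]expr1; apply: eigen_u => //; rewrite act_gx act_gX zeta3.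
by rewrite (linear_scale_of _ _ (act_linr actP x)) scaleNr opprK.
Qed.

Lemma act_g2_u : act (g ^+ 2) u = - u.
Proof.
rewrite expr2 (actM actP) /= act_g (linear_scale_of _ _ (act_linr actP g)) act_g.
by rewrite scalerA -expr2 zeta2 scaleN1r.
Qed.

Lemma u_neq0 : u != 0.
Proof.
apply/eqP => u0; have := lamX (isT : (1 < 4)%N) (isT : (1 < 4)%N).
rewrite expr1 u0 (linear0_of (lam_lin 1)) => /esym/eqP.
by rewrite oner_eq0.
Qed.

(** On u, x^2 = g^2 - 1 acts by -2. The value matters only through being nonzero: both coefficients
    can then be cancelled. *)
Lemma act_x_coefs : lam 3 (act x u) * lam 1 (act x (u ^+ 3)) = - 2%:R.
Proof.
have : act x (act x u) = - 2%:R *: u.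
  rewrite -(actM actP) /= (T421_xx HT) (linear_add_of _ _ (act_linl actP u)).
  rewrite (linear_opp_of _ (act_linl actP u)) act_g2_u (act1 actP).
  by rewrite scaleNr scaler_nat mulr2n opprD.
rewrite {1}act_x_u (linear_scale_of _ _ (act_linr actP x)) {1}act_x_u3 scalerA.
move/eqP; rewrite -subr_eq0 -scalerBl scaler_eq0 (negPf u_neq0) orbF subr_eq0.
by move/eqP.
Qed.

Lemma coaction_coef k j : exists c, forall q, lam j (T q (u ^+ k)) = pairing q c.
Proof.
apply: (@linear_form_dual K H (fun q => lam j (T q (u ^+ k)))).
exact: (linear_comp (lam_lin j) (linear_dact actP' _)).
Qed.

Lemma coaction_comm k j c : (j < 4)%N ->
  (forall q, lam j (T q (u ^+ k)) = pairing q c) ->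
  zeta ^+ j *: (g * c) = zeta ^+ k *: (c * g).
Proof.
move=> j4 cP; apply: pairing_sep => q.
(* The translate by g cancels S^-1(g) = g^3: q'(c) = q(g c) and q'(g^3 c g) = q(c g). *)
pose q' := dual_trans g 1 q.
have := hact_dact_grouplike actP' (antipode_inj HT) q' (u ^+ k) (T421_comul_g HT).
rewrite !hactE act_gX (Sinv_g HT).
move/(congr1 (lam j)); rewrite lam_act_g // (linear_scale_of _ _ (linear_dactr actP' _)).
rewrite lamZ !cP !dual_transE !mulr1 2!(mulrA g) -exprS (T421_g4 HT) mul1r => e.
by rewrite !pairingZ; exact: e.
Qed.

(** Using [coaction_comm] twice gives (-1)^j g^2 c = (-1)^k c g^2. Since g^2 is central and the
    parities differ, g^2 c is its own opposite. *)
Lemma coaction_even k j c : (j < 4)%N -> odd k -> ~~ odd j ->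
  (forall q, lam j (T q (u ^+ k)) = pairing q c) -> c = 0.
Proof.
move=> j4 ok ej /(coaction_comm j4) e.
have zX i : zeta ^+ i * zeta ^+ i = (-1) ^+ i.
  by rewrite -exprMn -expr2 zeta2.
have : zeta ^+ j *: (zeta ^+ j *: (g ^+ 2 * c)) =
    zeta ^+ k *: (zeta ^+ k *: (c * g ^+ 2)).
  transitivity (zeta ^+ j *: (g * (zeta ^+ j *: (g * c)))).
    by rewrite -[g * (_ *: _)]scalerAr mulrA.
  transitivity (zeta ^+ k *: ((zeta ^+ j *: (g * c)) * g)).
    by rewrite [in LHS]e -scalerAr -scalerAl !scalerA mulrC mulrA.
  by rewrite e -scalerAl -mulrA.
rewrite !scalerA !zX -(signr_odd _ j) -(signr_odd _ k) ok (negPf ej) scale1r scaleN1r.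
rewrite (g2_central HT) => /(eq_oppr_eq0 two_neq0) /(congr1 (fun h => h * g ^+ 2)).
by rewrite -mulrA -exprD (T421_g4 HT) mulr1 mul0r.
Qed.

(** The coefficients at 1 and u^2 vanish by parity; the factor [- zeta] in the last relation is
    zeta^3. *)
Lemma coaction_odd k : odd k -> exists c d,
  [/\ forall q, T q (u ^+ k) = pairing q c *: u + pairing q d *: u ^+ 3,
      zeta *: (g * c) = zeta ^+ k *: (c * g)
    & - zeta *: (g * d) = zeta ^+ k *: (d * g)].
Proof.
move=> ok.
have [c0 c0P] := coaction_coef k 0; have [c1 c1P] := coaction_coef k 1.
have [c2 c2P] := coaction_coef k 2; have [c3 c3P] := coaction_coef k 3.
exists c1, c3; split; last 2 first.
- by rewrite -(coaction_comm _ c1P).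
- by rewrite -(coaction_comm _ c3P) // zeta3.
move=> q; rewrite (lam_basis (T q _)) !big_ord_recl big_ord0 /= /bump /=.
rewrite c0P c1P c2P c3P (coaction_even _ ok _ c0P) // (coaction_even _ ok _ c2P) //.
by rewrite pairing0 !scale0r !add0r addr0 expr1.
Qed.

Lemma dactZ q c v : T q (c *: v) = c *: T q v.
Proof. exact: (linear_scale_of _ _ (linear_dactr actP' q)). Qed.

Lemma lam1u : lam 1 u = 1.
Proof. by have := lamX (isT : (1 < 4)%N) (isT : (1 < 4)%N); rewrite expr1. Qed.

Lemma lam3u : lam 3 u = 0.
Proof. by have := lamX (isT : (3 < 4)%N) (isT : (1 < 4)%N); rewrite expr1. Qed.

Lemma lam_u3 : (lam 1 (u ^+ 3) = 0) * (lam 3 (u ^+ 3) = 1).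
Proof. by rewrite !lamX. Qed.

Lemma no_double_extension : False.
Proof.
have z0 := zeta_neq0.
have [c1 [c3 [Tu e1 e3]]] := coaction_odd (isT : odd 1).
have [d1 [d3 [Tu3 f1 f3]]] := coaction_odd (isT : odd 3).
rewrite expr1 in Tu e1 e3; rewrite zeta3 in f1 f3.
have gc1 : g * c1 = c1 * g by apply: (scalerI z0).
have gd1 : g * d1 = - (d1 * g) by apply: (scalerI z0); rewrite f1 scaleNr scalerN.
have gd3 : g * d3 = d3 * g.
  by apply: (scalerI z0); apply: oppr_inj; rewrite -!scaleNr.
have {e1 e3 f1 f3} c1G := comm_gspan HT two_neq0 gc1.
have Sinj := antipode_inj HT.
(* The coproduct of c1 is c1 ⊗ c1 + d1 ⊗ c3; as c1 is a combination of
   grouplikes it is fixed by conjugating the first factor by g, while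
   this turns d1 into - d1. *)
have cd0 q p : pairing q c3 * pairing p d1 = 0.
  (* Read off as the coefficient of u in (r q).u = r.(q.u). *)
  have cop r : pairing (dual_mul S r q) c1 =
      pairing q c1 * pairing r c1 + pairing q c3 * pairing r d1.
    have := congr1 (lam 1) (dactM actP' Sinj r q u).
    rewrite !Tu (linear_add_of _ _ (linear_dactr actP' r)) !dactZ Tu Tu3.
    by rewrite !(lamD, lamZ) lam1u lam_u3 !mulr0 !mulr1 !addr0.
  have := dual_mul_conj_gspan HT p q c1G; rewrite !cop !dual_transE.
  have -> : g ^+ 3 * c1 * g = c1 by rewrite -mulrA -gc1 mulrA -exprSr (T421_g4 HT) mul1r.
  have -> : g ^+ 3 * d1 * g = - d1.
    by rewrite -mulrA -[d1 * g]opprK -gd1 mulrN mulrA -exprSr (T421_g4 HT) mul1r.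
  rewrite pairingN mulrN => /addrI/esym.
  exact: (@eq_oppr_eq0 K K^o).
have [prod1 prod2] : d3 * c1 + d1 * c3 = 1 /\ d1 * c1 + d3 * c3 = 0.
  have key p : pairing p (d3 * c1 + d1 * c3) *: (1 : A)
      + pairing p (d1 * c1 + d3 * c3) *: u ^+ 2 = pairing p 1 *: 1.
    have <- : T p (u * u ^+ 3) = pairing p 1 *: 1 by rewrite -exprS u4 (dact_one actP').
    rewrite (dact_mul actP').
    (* The product of p2.u and p1.u^3 is grouped by 1 and u^2, using u^6 = u^2; the scalars [1 *:]
       give the sums the shape that [tlift_comb] expects. *)
    transitivity (sweedler2 (@dual_comul K H) (fun p1 p2 =>
        1 *: (1 *: ((pairing p1 d3 * pairing p2 c1) *: (1 : A))
          + (pairing p1 d1 * pairing p2 c3) *: 1)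
        + (1 *: ((pairing p1 d1 * pairing p2 c1) *: u ^+ 2)
          + (pairing p1 d3 * pairing p2 c3) *: u ^+ 2)) p).
      rewrite /sweedler2 !tlift_comb -!/(sweedler2 _ _ _) !sweedler2_dual_pairing.
      by rewrite !scale1r -!scalerDl !pairingD.
    apply: eq_sweedler2 => p1 p2; rewrite Tu Tu3 mulrDl !mulrDr.
    rewrite [X in _ = X + _]addrC addrACA -!scalerAl -!scalerAr !scalerA !scale1r.
    have -> : u * u ^+ 3 = 1 by rewrite -exprS.
    have -> : u ^+ 3 * u = 1 by rewrite -exprSr.
    have -> : u ^+ 3 * u ^+ 3 = u ^+ 2 by rewrite -exprD (exprD u 4 2) u4 mul1r.
    by rewrite !mul1r -expr2 !(mulrC (pairing p2 _)).
  have key0 p : pairing p (d3 * c1 + d1 * c3) = pairing p 1.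
    have := congr1 (lam 0) (key p); rewrite lamD !lamZ -[1 : A](expr0 u) !lamX //.
    by rewrite mulr0 !mulr1 addr0.
  split; apply: pairing_sep => p //.
  have := congr1 (lam 2) (key p); rewrite lamD !lamZ -[1 : A](expr0 u) !lamX //.
  by rewrite !mulr0 mulr1 add0r pairing0.
have d3c1 : d3 * c1 = c1 * d3 by rewrite -(gspan_comm gd3 c1G).
(* [cd0] says d1 ⊗ c3 = 0; contracting the first factor with p leaves a multiple of c3, so one of
   the two factors is zero. *)
have scal p : pairing p d1 *: c3 = 0.
  apply: pairing_sep => q; rewrite pairing0.
  by rewrite pairingZ -(cd0 q p) mulrC.
have d1c3 : d1 = 0 \/ c3 = 0.
  case: (eqVneq c3 0) => [|c3n]; [by right|left].
  apply: pairing_sep => p; rewrite pairing0.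
  by have /eqP := scal p; rewrite scaler_eq0 (negPf c3n) orbF => /eqP.
(* In either case the first product relation makes c1 and d3 mutually inverse, and the second one
   then kills the remaining coefficient. *)
have [d10 c30] : d1 = 0 /\ c3 = 0.
  case: d1c3 => e; split=> //; move: prod1 prod2; rewrite e.
    rewrite !mul0r addr0 add0r d3c1 => cd dc.
    by rewrite -[c3]mul1r -cd -mulrA dc mulr0.
  rewrite !mulr0 !addr0 d3c1 => cd dc.
  by rewrite -[d1]mulr1 -cd mulrA dc mul0r.
have {}prod1 : d3 * c1 = 1 by rewrite -prod1 d10 mul0r addr0.
have {}Tu q : T q u = pairing q c1 *: u.
  by rewrite Tu c30 pairing0 scale0r addr0.
have {}Tu3 q : T q (u ^+ 3) = pairing q d3 *: u ^+ 3.
  by rewrite Tu3 d10 pairing0 scale0r add0r.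
have xcoef := act_x_coefs.
have nz2 : - 2%:R != 0 :> K by rewrite oppr_eq0.
have [ga0 de0] : lam 3 (act x u) != 0 /\ lam 1 (act x (u ^+ 3)) != 0.
  by apply/andP; rewrite -negb_or -mulf_eq0 xcoef.
have [ga xu {}ga0] : exists2 ga, act x u = ga *: u ^+ 3 & ga != 0.
  by exists (lam 3 (act x u)) => //; exact: act_x_u.
have [de xu3 {}de0] : exists2 de, act x (u ^+ 3) = de *: u & de != 0.
  by exists (lam 1 (act x (u ^+ 3))) => //; exact: act_x_u3.
(* In the skew relation on u, the first and last terms on the right are multiples of u. The
   coefficient of u^3 keeps only the term through x.u and gives q(c1) = q(d3 g). The next step
   exchanges the roles of u and u^3. *)
have cdg : c1 = d3 * g.
  apply: pairing_sep => q.
  have := hact_dact_skew actP' Sinj q u (T421_comul_g HT) (T421_comul_x HT).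
  rewrite !hactE act_g xu !dactZ !Tu Tu3 (linear_scale_of _ _ (act_linr actP x)) xu.
  move/(congr1 (lam 3)); rewrite !lamD !lamZ lam3u lam_u3 !mulr0 add0r addr0 !mulr1.
  by rewrite dual_transE mul1r mulrC => /(mulfI ga0).
have dcg : d3 = c1 * g.
  apply: pairing_sep => q.
  have := hact_dact_skew actP' Sinj q (u ^+ 3) (T421_comul_g HT) (T421_comul_x HT).
  rewrite !hactE act_gX xu3 !dactZ !Tu3 Tu (linear_scale_of _ _ (act_linr actP x)) xu3.
  move/(congr1 (lam 1)); rewrite !lamD !lamZ lam1u lam_u3 !mulr0 add0r addr0 !mulr1.
  by rewrite dual_transE mul1r mulrC => /(mulfI de0).
have g21 : g ^+ 2 = 1.
  (* The chain is g^2 = d3 c1 g g = d3 d3 g = d3 c1 = 1. *)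
  by rewrite -[LHS]mul1r -{1}prod1 -mulrA expr2 [c1 * _]mulrA -dcg -cdg prod1.
have := act_g2_u; rewrite g21 (act1 actP) => /(eq_oppr_eq0 two_neq0)/eqP.
by rewrite (negPf u_neq0).
Qed.

End Obstruction.

(** * Coordinates in the quotient of K[X] by X^4 - 1 *)

Section Cyclic.
Variable K : fieldType.
Local Notation h := ('X^4 - 1 : {poly K}).
Local Notation A := {poly %/ h}.

(** The quotient type reduces modulo [mk_monic h], which agrees with h because h is monic and
    nonconstant. *)
Lemma mk_monic_X4_sub1 : mk_monic h = h.
Proof. by rewrite /mk_monic size_XnsubC // monicXnsubC. Qed.

Lemma size_mk_monic_X4_sub1 : size (mk_monic h) = 5%N.
Proof. by rewrite mk_monic_X4_sub1 size_XnsubC. Qed.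

Lemma qXE j : 'qX ^+ j = in_qpoly h 'X^j.
Proof. by rewrite rmorphXn. Qed.

Lemma qX4 : 'qX ^+ 4 = 1 :> A.
Proof.
have h0 : in_qpoly h h = 0.
  by apply: val_inj; rewrite /= mk_monic_X4_sub1 Pdiv.RingMonic.rmodpp // monicXnsubC.
by apply/eqP; rewrite qXE -subr_eq0 -(in_qpoly1 h) -raddfB /= h0.
Qed.

Lemma coef_qX i j : (j < 4)%N -> (polyn ('qX ^+ j : A))`_i = (i == j)%:R.
Proof.
move=> j4; rewrite qXE in_qpoly_small ?coefXn //.
by rewrite size_mk_monic_X4_sub1 size_polyXn ltnS.
Qed.

Lemma qpoly_expand (a : A) : a = \sum_(j < 4) (polyn a)`_j *: 'qX ^+ j.
Proof.
have {1}-> : a = in_qpoly h (polyn a).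
  by apply/val_inj/esym/in_qpoly_small; apply: size_mk_monic.
have {1}-> : polyn a = \poly_(j < 4) (polyn a)`_j.
  (* The canonical representative has size less than 5, hence no coefficient from index 4 on. *)
  apply/polyP => j; rewrite coef_poly; case: ltnP => // j4.
  rewrite nth_default // (leq_trans _ j4) // -ltnS.
  by rewrite -size_mk_monic_X4_sub1 size_mk_monic.
rewrite poly_def linear_sum; apply: eq_bigr => j _.
by rewrite linearZ /= qXE.
Qed.

End Cyclic.

Theorem proposition5p7 (K : closedFieldType) (charK0 : [pchar K] =i pred0)
    (H : falgType K) (S : hopf_struct H) (g x : H) (HT : is_T421 S g x)
    (zeta : K) (zetaP : 4.-primitive_root zeta)
    (act : H -> {poly %/ ('X^4 - 1 : {poly K})} -> {poly %/ ('X^4 - 1 : {poly K})})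
    (actP : module_algebra (hopf_ops S) act)
    (act_faithful : inner_faithful S act)
    (act_g : act g 'qX = zeta *: 'qX) :
  ~ exists act' : drinfeld_double H ->
        {poly %/ ('X^4 - 1 : {poly K})} -> {poly %/ ('X^4 - 1 : {poly K})},
      module_algebra (drinfeld_ops S) act' /\
      forall h a, act' (drinfeld_incl S h) a = act h a.
Proof.
case=> act' [actP' act_ext].
have two_neq0 : 2%:R != 0 :> K.
  by have := charK0 2%N; rewrite inE /= => /negbT.
(* The coordinates of a class are the coefficients of its canonical representative. *)
pose lam j (a : {poly %/ ('X^4 - 1 : {poly K})}) := (polyn a)`_j.
apply: (no_double_extension HT zetaP two_neq0 (qX4 K) (lam := lam)
  _ _ _ actP act_g actP' act_ext).
- by move=> j c a b; rewrite /lam coefD coefZ.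
- exact: qpoly_expand.
- by move=> i j _ j4; apply: coef_qX.
Qed.
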